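(* Let $(X,Y)$ be a couple of random variables with joint distribution $\mathbb{P}\in\mathcal{M}_\Theta\cap\mathcal{M}_{\mathcal{G}}$ (notation as in the context). Suppose that either conditions (A.1), (A.2), (A.5), (A.6), (A.7), (A.10) and (A.12.b), or conditions (A.1), (A.2), (A.5) and (A.12.a), are satisfied, where: (A.1) if $h_\theta(x,y)=h_{\theta'}(x,y)$ for all $(x,y)\in\mathcal{X}\times\mathcal{Y}$, then $\theta=\theta'$; (A.2) there exists a (unique) $\theta_0$ in the interior of $\Theta$ satisfying $h_{\theta_0}(x,y)=1$ for all $(x,y)\in\mathcal{X}\times\mathcal{Y}$; (A.5) the parameter space $\Theta$ is a compact subset of $\mathbb{R}\times\mathbb{R}^d$; (A.6) $\int_{\mathcal{X}\times\mathcal{Y}}\sup_{\theta\in\Theta}|f_\theta(x,y)|\,d\mathbb{P}(x,y)<\infty$; (A.7) $\int_{\mathcal{X}\times\mathcal{Y}}\sup_{\theta\in\Theta}g_\theta(x,y)^2\,d\mathbb{P}^\perp(x,y)<\infty$; (A.10) for all $f\in\mathcal{G}$ and all $a>0$, $\int_{\mathcal{X}\times\mathcal{Y}}\exp(a|f|)\,d\mathbb{P}<\infty$; (A.12.a) $(X,Y)$ is finite-discrete, supported by $\mathcal{X}\times\mathcal{Y}$; (A.12.b) the model $\{h_\theta;\ \theta=(\alpha,\beta^\top)^\top\in\Theta\}$ is of the form $h_\theta(x,y)=\exp(\alpha+m_\beta(x,y))$, with the condition that, for any constant $c$ and any $\beta$, $\mathbb{P}^\perp(m_\beta(X,Y)=c)\neq0$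 if and only if $\beta=(0,\dots,0)^\top$ and $c=0$. Then, for the problem of testing $\mathcal{H}_0$: $X$ and $Y$ are independent, against $\mathcal{H}_1$: $X$ and $Y$ are dependent, the test based on the estimate $\widehat I_{\varphi_1}$ of the Kullback-Leibler mutual information, $\varphi_1(x)=x\log x-x+1$, is uniformly (i.e., whatever be the alternative $\mathbb{P}\neq\mathbb{P}^\perp$) the most efficient test, in the Bahadur sense, among all $\widehat I_\varphi$-based tests, including the classical $\chi^2$-independence one.
   Context: Let $\mathcal{X}\times\mathcal{Y}$ be a product measurable space and $\mathcal{M}_1$ the set of all probability distributions on it. For $P\in\mathcal{M}_1$ with margins $P_1,P_2$, put $P^\perp:=P_1\otimes P_2$. $\mathbb{P}$ is the joint distribution of $(X,Y)$. **Function $\varphi$.** $\varphi:\mathbb{R}\to[0,+\infty]$ is a closed proper convex function whose domain is an interval with endpoints $a_\varphi<1<b_\varphi$ (bounded or not, open or not), with $\varphi(1)=0$; it is strictly convex and twice continuously differentiable on the interior of its domain, with $\varphi'(1)=0$ and $\varphi''(1)=1$, and essentially smooth: differentiable on $]a_\varphi,b_\varphi[$ with $\lim_{x\downarrow a_\varphi}\varphi'(x)=-\infty$ if $a_\varphi>-\infty$ and $\lim_{x\uparrow b_\varphi}\varphi'(x)=+\infty$ if $b_\varphi<+\infty$. Its convex conjugate is $\varphi^*(t):=\sup_{x\in\mathbb{R}}\{tx-\varphi(x)\}$. For $Q,P\in\mathcal{M}_1$, $D_\varphi(Q,P):=\int\varphi(dQ/dP)\,dP$ if $Q$ is absolutely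 continuous with respect to $P$, and $+\infty$ otherwise. The $\varphi$-mutual information is $I_\varphi(P):=D_\varphi(P,P^\perp)$. The Kullback-Leibler divergence is $\mathbb{K}:=D_{\varphi_1}$, with $\varphi_1(x)=x\log x-x+1$, and $I_{\varphi_1}$ is the Kullback-Leibler mutual information; the $\chi^2$-mutual information is $I_{\varphi_2}$, with $\varphi_2(x)=(x-1)^2/2$. **Model.** For $\Theta\subset\mathbb{R}^{1+d}$ and specified real-valued functions $h_\theta$ on $\mathcal{X}\times\mathcal{Y}$, $\theta\in\Theta$, let $\mathcal{M}_\Theta:=\{P\in\mathcal{M}_1:\ dP/dP^\perp=h_\theta\text{ for some }\theta\in\Theta\}$. The true parameter $\theta_T$ is the unique value with $d\mathbb{P}/d\mathbb{P}^\perp=h_{\theta_T}$; it is assumed to be an interior point of $\Theta$. Put $f_\theta:=\varphi'(h_\theta)$ and $g_\theta:=\varphi^*(\varphi'(h_\theta))=h_\theta\varphi'(h_\theta)-\varphi(h_\theta)$, which are assumed continuous in $\theta$ on $\Theta$. **Estimate and test.** For i.i.d. copies $(X_1,Y_1),\dots,(X_n,Y_n)$ of $(X,Y)$, $$\widehat I_\varphi:=\sup_{\theta\in\Theta}\Big\{\frac1n\sum_{i=1}^nf_\theta(X_i,Y_i)-\frac1{n^2}\sum_{i=1}^n\sum_{j=1}^ng_\theta(X_i,Y_j)\Big\}.$$ The $\widehat I_\varphi$-based test rejects $\mathcal{H}_0$ when $\widehat I_\varphi$ takes large values. **Classes.** $\mathcal{B}$ is the set of all bounded measurable functions from $\mathcal{X}\times\mathcal{Y}$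 into $\mathbb{R}$; $$\mathcal{G}:=\mathcal{B}\cup\{\varphi'(h_\theta);\theta\in\Theta\}\cup\{\varphi^*(\varphi'(h_\theta));\theta\in\Theta\};$$ $$\mathcal{M}_{\mathcal{G}}:=\Big\{P\in\mathcal{M}_1:\int|\varphi'(h_\theta)|\,dP<\infty,\ \int|\varphi^*(\varphi'(h_\theta))|\,dP^\perp<\infty,\ \forall\theta\in\Theta\Big\}.$$ The objects $f_\theta$, $g_\theta$, $\mathcal{G}$, $\mathcal{M}_{\mathcal{G}}$ depend on $\varphi$; this is omitted from the notation. In the finite-discrete case (A.12.a), $\mathcal{M}_{\mathcal{G}}$ is replaced by the set of all finite-discrete distributions with the same finite support $\mathcal{X}\times\mathcal{Y}$. For $Q\in\mathcal{M}_{\mathcal{G}}$, $$\mathcal{D}_\varphi(Q,Q^\perp):=\sup_{\theta\in\Theta}\Big\{\int\varphi'(h_\theta)\,dQ-\int\varphi^*(\varphi'(h_\theta))\,dQ^\perp\Big\}.$$ **Bahadur efficiency.** For an alternative $\mathbb{P}\neq\mathbb{P}^\perp$, level $\alpha\in(0,1)$ and power $\gamma\in(0,1)$, let $n_\varphi(\alpha,\gamma,\mathbb{P})$ be the minimal number of observations needed for the $\widehat I_\varphi$-based test to have significance level $\alpha$ and power $\gamma$. The Bahadur asymptotic relative efficiency of the $\widehat I_\varphi$-based test with respect to the $\widehat I_{\tilde\varphi}$-based test is $\lim_{\alpha\to0}n_{\tilde\varphi}(\alpha,\gamma,\mathbb{P})/n_\varphi(\alpha,\gamma,\mathbb{P})$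 (if the limit exists). It equals the ratio $s_\varphi/s_{\tilde\varphi}$ of Bahadur slopes when both statistics satisfy a large deviation principle under the null hypothesis, with good rate functions $e_\varphi$ and $e_{\tilde\varphi}$, and a law of large numbers under the alternative, with asymptotic means $\mu_\varphi(\mathbb{P})$ and $\mu_{\tilde\varphi}(\mathbb{P})$, where $s_\varphi:=e_\varphi(\mu_\varphi(\mathbb{P}))$. Here $\mu_\varphi(\mathbb{P})=I_\varphi(\mathbb{P})$ and $$e_\varphi(d)=\inf\big\{\mathbb{K}(Q,\mathbb{P}^\perp):\ Q\in\mathcal{M}_{\mathcal{G}},\ \mathcal{D}_\varphi(Q,Q^\perp)\ge d\big\},\quad d>0.$$ The most efficient test in the Bahadur sense is the one maximizing the Bahadur slope $s_\varphi$. *)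

(* Defs.v *)
From HB Require Import structures.
From mathcomp Require Import all_boot all_order all_algebra.
From mathcomp Require Import all_classical all_reals all_analysis.

Set Implicit Arguments.
Unset Strict Implicit.
Unset Printing Implicit Defensive.

Import Order.TTheory GRing.Theory Num.Theory.
Import numFieldNormedType.Exports.

Local Open Scope classical_set_scope.
Local Open Scope ring_scope.
Local Open Scope ereal_scope.
Local Open Scope charge_scope.

Section divergence_functions.
Context {R : realType}.
Implicit Types phi : R -> \bar R.

Definition edom phi : set R := [set x | phi x < +oo].

Definition inf_dom phi : \bar R := ereal_inf (EFin @` edom phi).

Definition sup_dom phi : \bar R := ereal_sup (EFin @` edom phi).

(* By convexity [edom phi] is an interval, and this is its interior. *)
Definition int_dom phi : set R :=
  [set x | inf_dom phi < x%:E < sup_dom phi].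

(* phi is finite on [int_dom phi], hence near each of its points, so that the
   derivatives of [fine \o phi] are those of phi there; elsewhere the value is
   irrelevant. *)
Definition dphi phi : R -> R := (fine \o phi)^`()%classic.

Record divergence_function phi : Prop := {
  divf_ge0 : forall x, 0 <= phi x ;
  divf_convex : forall (x y t : R), (0 <= t <= 1)%R ->
    phi (t * x + (1 - t) * y)%R <= t%:E * phi x + (1 - t)%:E * phi y ;
  divf_closed : lower_semicontinuous phi ;
  divf_inf_dom : inf_dom phi < 1 ;
  divf_sup_dom : 1 < sup_dom phi ;
  divf_at1 : phi 1%R = 0 ;
  divf_strictly_convex : forall x y t : R, int_dom phi x -> int_dom phi y ->
    x <> y -> (0 < t < 1)%R ->
    phi (t * x + (1 - t) * y)%R < t%:E * phi x + (1 - t)%:E * phi y ;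
  divf_derivable : forall x, int_dom phi x -> derivable (fine \o phi) x 1%R ;
  divf_derivable2 : forall x, int_dom phi x -> derivable (dphi phi) x 1%R ;
  divf_continuous2 : forall x, int_dom phi x ->
    {for x, continuous (dphi phi)^`()%classic} ;
  divf_deriv1_at1 : dphi phi 1%R = 0%R ;
  divf_deriv2_at1 : ((dphi phi)^`()%classic) 1%R = 1%R ;
  divf_steep_inf : forall a : R, inf_dom phi = a%:E ->
    dphi phi x @[x --> a^'+] --> -oo%R ;
  divf_steep_sup : forall b : R, sup_dom phi = b%:E ->
    dphi phi x @[x --> b^'-] --> +oo%R }.

Definition conjugate phi (t : R) : \bar R :=
  ereal_sup [set (t * x)%:E - phi x | x in [set: R]].

(* x log x - x + 1 on [0, +oo[, with 0 log 0 = 0 (in the library ln 0 = 0) *)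
Definition kl_fun (x : R) : \bar R :=
  if (x < 0)%R then +oo else (x * ln x - x + 1)%:E.

Definition chi2_fun (x : R) : \bar R := ((x - 1) ^+ 2 / 2)%:E.

Definition divergence d (T : measurableType d) phi (Q P : probability T R) :
    \bar R :=
  if `[< Q `<< P >]
  then \int[P]_z phi (fine ('d (charge_of_finite_measure Q) '/d P z))
  else +oo.

(* dQ/dP = f *)
Definition has_density d (T : measurableType d) (Q P : probability T R)
    (f : T -> R) : Prop :=
  Q `<< P /\
  {ae P, forall z, 'd (charge_of_finite_measure Q) '/d P z = (f z)%:E}.

End divergence_functions.

Section mutual_information.
Context {R : realType} {dX dY : measure_display}
  {X : measurableType dX} {Y : measurableType dY}.
Implicit Types (P Q : probability (X * Y)%type R) (phi : R -> \bar R).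

HB.instance Definition _ :=
  isMeasurableFun.Build _ _ _ _ (@fst X Y) measurable_fst.
HB.instance Definition _ :=
  isMeasurableFun.Build _ _ _ _ (@snd X Y) measurable_snd.

Definition margin1 P : probability X R := distribution P (@fst X Y).

Definition margin2 P : probability Y R := distribution P (@snd X Y).

Definition perp P : probability (X * Y)%type R := margin1 P \x margin2 P.

Definition independent P : Prop :=
  forall A, measurable A -> P A = perp P A.

Definition mutual_information phi P : \bar R := divergence phi P (perp P).

End mutual_information.

Section density_ratio_model.
Context {R : realType} {dX dY : measure_display}
  {X : measurableType dX} {Y : measurableType dY} {d : nat}.
Local Notation prob := (probability (X * Y)%type R).
Variables (Theta : set 'rV[R]_(1 + d)) (h : 'rV[R]_(1 + d) -> X * Y -> R).
Implicit Types (P Q : prob) (phi : R -> \bar R).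

Definition model : set prob :=
  [set P : prob | exists2 theta, Theta theta & has_density P (perp P) (h theta)].

Definition f_ phi (theta : 'rV[R]_(1 + d)) (z : X * Y) : R :=
  dphi phi (h theta z).

(* phi^* (phi' (h theta)); finite as soon as [h theta z] is in [int_dom phi] *)
Definition g_ phi (theta : 'rV[R]_(1 + d)) (z : X * Y) : R :=
  fine (conjugate phi (dphi phi (h theta z))).

(* The first condition is what makes phi' (h theta) a real-valued function:
   phi is steep, hence not differentiable at the endpoints of its domain. *)
Definition regular_model phi : Prop :=
  [/\ forall theta z, Theta theta -> int_dom phi (h theta z),
      forall z, {within Theta, continuous (fun theta => f_ phi theta z)} &
      forall z, {within Theta, continuous (fun theta => g_ phi theta z)}].

Definition identifiable : Prop :=
  forall theta theta', Theta theta -> Theta theta' ->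
    (forall z, h theta z = h theta' z) -> theta = theta'.

Definition interior_null : Prop :=
  exists2 theta0, Theta^° theta0 & forall z, h theta0 z = 1%R.

Definition true_parameter P (thetaT : 'rV[R]_(1 + d)) : Prop :=
  forall theta, Theta theta ->
    has_density P (perp P) (h theta) <-> theta = thetaT.

Definition bounded_mfun : set (X * Y -> R) :=
  [set f : X * Y -> R | measurable_fun setT f /\ exists M : R, forall z, (`|f z| <= M)%R].

Definition test_class phi : set (X * Y -> R) :=
  bounded_mfun `|` f_ phi @` Theta `|` g_ phi @` Theta.

Definition M_G phi : set prob :=
  [set P : prob | forall theta, Theta theta ->
    P.-integrable setT (EFin \o f_ phi theta) /\
    (perp P).-integrable setT (EFin \o g_ phi theta)].

Definition finite_discrete : set prob :=
  [set P : prob | [/\ finite_set [set: X], finite_set [set: Y],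
      forall z : X * Y, measurable [set z] & forall z, 0 < P [set z]]].

Definition f_envelope_integrable phi P : Prop :=
  \int[P]_z ereal_sup [set `|f_ phi theta z|%:E | theta in Theta] < +oo.

Definition g_envelope_sq_integrable phi P : Prop :=
  \int[perp P]_z ereal_sup [set (g_ phi theta z ^+ 2)%:E | theta in Theta]
    < +oo.

Definition exponential_moments phi P : Prop :=
  forall f, test_class phi f -> forall a : R, (0 < a)%R ->
    \int[P]_z (expR (a * `|f z|))%:E < +oo.

(* theta is the block row (alpha, beta^T) *)
Definition exponential_model P : Prop :=
  exists m : 'rV[R]_d -> X * Y -> R,
    (forall theta z, Theta theta ->
       h theta z = expR (lsubmx theta ord0 ord0 + m (rsubmx theta) z)) /\
    (forall theta (c : R), Theta theta ->
       perp P [set z | m (rsubmx theta) z = c] <> 0 <->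
       rsubmx theta = 0%R /\ c = 0%R).

Definition dual_divergence phi Q : \bar R :=
  ereal_sup [set \int[Q]_z (f_ phi theta z)%:E
                 - \int[perp Q]_z (g_ phi theta z)%:E | theta in Theta].

Section bahadur.
(* [M phi] is the set of distributions over which the rate function is
   minimized: [M_G phi] or [finite_discrete] *)
Variable M : (R -> \bar R) -> set prob.

(* Good rate function, for samples of size n drawn from perp P and at speed n,
   of the large deviations of the test statistic
     sup_theta [ n^-1 sum_i f_ phi theta (X_i, Y_i)
                 - n^-2 sum_(i, j) g_ phi theta (X_i, Y_j) ];
   Q stands for the limiting empirical distribution of the pairs. *)
Definition rate_function phi P (t : \bar R) : \bar R :=
  ereal_inf [set divergence kl_fun Q (perp P) |
    Q in [set Q : prob | M phi Q /\ t <= dual_divergence phi Q]].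

(* [mutual_information phi P] is the almost sure limit of that statistic for
   samples drawn from P. *)
Definition bahadur_slope phi P : \bar R :=
  rate_function phi P (mutual_information phi P).

(* [C phi]: the conditions under which the test based on phi is considered *)
Definition bahadur_most_efficient (C : (R -> \bar R) -> Prop) phi0 P : Prop :=
  divergence_function phi0 /\
  forall phi, divergence_function phi -> C phi ->
    bahadur_slope phi P <= bahadur_slope phi0 P.

End bahadur.

Definition regular_exponential_case P phi : Prop :=
  [/\ regular_model phi, M_G phi P, f_envelope_integrable phi P,
      g_envelope_sq_integrable phi P & exponential_moments phi P].

End density_ratio_model.

(* Main.v *)
(** The distribution P itself satisfies the constraint that defines the rate
    function at the mutual information, because the dual formula is attained at
    the true parameter; hence every slope is at most K(P, P^perp). For the
    Kullback-Leibler divergence the slope equals this bound: if the dual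
    divergence of Q is at least K(P, P^perp), then

      K(Q, P^perp) >= K(Q, Q^perp) >= dual divergence of Q >= K(P, P^perp).

    The first two inequalities are proved at once, by integrating against
    P^perp the tangent inequality x ln x - x >= x ln w - w at x = dQ/dP^perp and
    w = u q1 q2, where u is a function of the model and q1, q2 are the densities
    of the margins of Q with respect to those of P, after bounding ln q1 and
    ln q2 from below by 1 - 1/q1 and 1 - 1/q2. *)

Require Import Defs.
From HB Require Import structures.
From mathcomp Require Import all_boot all_order all_algebra.
From mathcomp Require Import all_classical all_reals all_analysis.
From mathcomp Require Import measurable_realfun ring lra.

Set Implicit Arguments.
Unset Strict Implicit.
Unset Printing Implicit Defensive.

Import Order.TTheory GRing.Theory Num.Theory.
Import numFieldNormedType.Exports.

Local Open Scope classical_set_scope.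
Local Open Scope ring_scope.
Local Open Scope ereal_scope.

(** * The Kullback-Leibler function and its tangents *)

Section kl_function.
Context {R : realType}.
Implicit Types x y w t : R.

(** For [x > 0], division by [x] turns this into [1 + t < expR t] at [t = ln (w / x)]. Up to the
    constant 1, the left-hand side is the tangent of [kl_fun] at [w], as an affine function of
    [x]. *)
Lemma mul_ln_gt_tangent x w : (0 <= x)%R -> (0 < w)%R -> x != w ->
  (x * ln w - w < x * ln x - x)%R.
Proof.
move=> x0 w0 xw; have [<-|xn0] := eqVneq 0%R x.
  by rewrite !mul0r subr0 sub0r oppr_lt0.
have xp : (0 < x)%R by rewrite lt_neqAle xn0.
have : (1 + ln (w / x) < w / x)%R.
  rewrite -[ltRHS]lnK ?posrE ?divr_gt0// expR_gt1Dx// ln_eq0 ?divr_gt0//.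
  by apply: contra xw => /eqP/divr1_eq ->.
rewrite ln_div ?posrE// -(ltr_pM2l xp) mulrCA divff ?gt_eqF// mulr1.
by nra.
Qed.

Lemma mul_ln_ge_tangent x w : (0 <= x)%R -> (0 < w)%R ->
  (x * ln w - w <= x * ln x - x)%R.
Proof.
by move=> x0 w0; have [->//|xw] := eqVneq x w; exact/ltW/mul_ln_gt_tangent.
Qed.

Lemma kl_funE x : (0 <= x)%R -> kl_fun x = (x * ln x - x + 1)%:E.
Proof. by rewrite /kl_fun leNgt => /negbTE ->. Qed.

Lemma kl_fun_lt0 x : (x < 0)%R -> kl_fun x = +oo.
Proof. by rewrite /kl_fun => ->. Qed.

Lemma kl_fun_ge_tangent x w : (0 < w)%R ->
  (x * ln w - w + 1)%:E <= kl_fun x.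
Proof.
move=> w0; have [x0|x0] := ltP x 0%R; first by rewrite kl_fun_lt0 ?leey.
by rewrite kl_funE// lee_fin lerD2r mul_ln_ge_tangent.
Qed.

Lemma kl_fun_ge0 x : 0 <= kl_fun x.
Proof.
by apply: le_trans (kl_fun_ge_tangent x ltr01); rewrite ln1 mulr0 sub0r addNr.
Qed.

(** The tangent at the barycenter lies below [kl_fun] at [x] and at [y], and averaging the two
    inequalities gives the claim. The weights 0 and 1 are treated first, so that an infinite value
    is never multiplied by 0. *)
Lemma kl_fun_convex x y t : (0 <= t <= 1)%R ->
  kl_fun (t * x + (1 - t) * y)%R <= t%:E * kl_fun x + (1 - t)%:E * kl_fun y.
Proof.
move=> /andP[t0 t1].
have [->|tn0] := eqVneq t 0%R; first by
  rewrite mul0e subr0 mul1e add0e mul0r mul1r add0r.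
have [->|tn1] := eqVneq t 1%R; first by
  rewrite subrr mul0e mul1e adde0 mul0r mul1r addr0.
have tp : (0 < t)%R by rewrite lt_neqAle eq_sym tn0.
have t1p : (0 < 1 - t)%R by rewrite subr_gt0 lt_neqAle tn1.
have [x0|x0] := ltP x 0%R.
  rewrite (kl_fun_lt0 x0) gt0_muley ?lte_fin// addye ?leey//.
  by rewrite -ltNye (lt_le_trans ltNy0)// mule_ge0 ?kl_fun_ge0// lee_fin ltW.
have [y0|y0] := ltP y 0%R.
  rewrite (kl_fun_lt0 y0) gt0_muley ?lte_fin// addey ?leey//.
  by rewrite -ltNye (lt_le_trans ltNy0)// mule_ge0 ?kl_fun_ge0// lee_fin ltW.
set w := (t * x + (1 - t) * y)%R.
have w0 : (0 <= w)%R by rewrite addr_ge0// mulr_ge0// ltW.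
rewrite !kl_funE// -!EFinM -EFinD lee_fin.
(* There is no tangent at 0, but a null barycenter of nonnegative points with positive weights
   forces both points to be 0. *)
have [wE|wn0] := eqVneq w 0%R.
  move: wE => /eqP; rewrite paddr_eq0 ?mulr_ge0 ?(ltW t1p)// !mulf_eq0.
  rewrite (negbTE tn0) (gt_eqF t1p)/= => /andP[/eqP xE /eqP yE].
  by rewrite /w xE yE !mulr0 addr0 !mul0r; lra.
have wp : (0 < w)%R by rewrite lt_neqAle eq_sym wn0.
have hx := mul_ln_ge_tangent x0 wp; have hy := mul_ln_ge_tangent y0 wp.
rewrite -(ler_pM2l tp) in hx; rewrite -(ler_pM2l t1p) in hy.
have -> : (w * ln w = t * (x * ln w) + (1 - t) * (y * ln w))%R by rewrite /w; ring.
by lra.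
Qed.

Lemma edom_kl_fun : edom (@kl_fun R) = [set x | (0 <= x)%R].
Proof.
apply/seteqP; split=> x; rewrite /edom/=; last first.
  by move=> x0; rewrite kl_funE ?ltry.
by rewrite leNgt; apply: contraPN => /kl_fun_lt0 ->; rewrite ltxx.
Qed.

Lemma inf_dom_kl_fun : inf_dom (@kl_fun R) = 0.
Proof.
apply/eqP; rewrite eq_le; apply/andP; split.
  by apply: ereal_inf_lbound; exists 0%R => //; rewrite edom_kl_fun /=.
by apply: le_ereal_inf_tmp => _ [x + <-]; rewrite edom_kl_fun /= lee_fin.
Qed.

Lemma sup_dom_kl_fun : sup_dom (@kl_fun R) = +oo.
Proof.
apply/eqyP => r r0; apply: ereal_sup_ubound; exists r => //.
by rewrite edom_kl_fun /= ltW.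
Qed.

Lemma int_dom_kl_fun : int_dom (@kl_fun R) = [set x | (0 < x)%R].
Proof.
apply/seteqP; split=> x; rewrite /int_dom /= inf_dom_kl_fun sup_dom_kl_fun ltry;
  by rewrite andbT lte_fin.
Qed.

Lemma near_kl_fun x : (0 < x)%R ->
  \near x, (x * ln x - x + 1)%R = (fine \o kl_fun) x.
Proof.
move=> x0; near=> y; rewrite /= kl_funE//; apply: ltW.
by near: y; exact: lt_nbhsr.
Unshelve. all: by end_near. Qed.

Lemma is_derive_kl_fun x : (0 < x)%R -> is_derive x 1%R (fine \o kl_fun) (ln x).
Proof.
move=> x0; apply: near_eq_is_derive (near_kl_fun x0) _.
have dln := is_derive1_ln x0.
apply: is_derive_eq; rewrite /= addr0 /GRing.scale /= divff ?gt_eqF//.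
by rewrite mulr1; ring.
Qed.

Lemma dphi_kl_fun x : (0 < x)%R -> dphi kl_fun x = ln x.
Proof.
by move=> x0; rewrite /dphi derive1E; have [_ ->] := is_derive_kl_fun x0.
Qed.

Lemma near_dphi_kl_fun x : (0 < x)%R -> \near x, ln x = dphi kl_fun x.
Proof.
move=> x0; near=> y; rewrite dphi_kl_fun//.
by near: y; exact: lt_nbhsr.
Unshelve. all: by end_near. Qed.

Lemma is_derive_dphi_kl_fun x : (0 < x)%R ->
  is_derive x 1%R (dphi kl_fun) x^-1%R.
Proof.
by move=> x0; apply: near_eq_is_derive (near_dphi_kl_fun x0) (is_derive1_ln x0).
Qed.

Lemma derive1_dphi_kl_fun x : (0 < x)%R -> ((dphi kl_fun)^`()%classic) x = x^-1%R.
Proof.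
by move=> x0; rewrite derive1E; have [_ ->] := is_derive_dphi_kl_fun x0.
Qed.

(** At [x >= 0], some tangent exceeds the level [a] at [x]; being continuous, it does so near [x],
    and it minorizes [kl_fun]. *)
Lemma lower_semicontinuous_kl_fun : lower_semicontinuous (@kl_fun R).
Proof.
move=> x a ax.
have [x0|x0] := ltP x 0%R.
  exists [set y | (y < 0)%R]; first exact: lt_nbhsl.
  by move=> y /kl_fun_lt0 ->; exact: ltry.
have [w w0 aw] : exists2 w : R, (0 < w)%R & (a < x * ln w - w + 1)%R.
  move: ax; rewrite kl_funE// lte_fin; have [<-|xn0] := eqVneq 0%R x => ax.
    (* At [x = 0] the tangent at [w] has value [1 - w], to be kept above [a], where [a < 1] because
       [kl_fun] is 1 at 0. *)
    exists ((1 - a) / 2)%R; first by rewrite !mul0r in ax *; lra.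
    by rewrite !mul0r in ax *; lra.
  by exists x => //; rewrite lt_neqAle xn0.
exists [set y | (a < y * ln w - w + 1)%R].
  have cf : {for x, continuous (fun y : R => (y * ln w - w + 1)%R)}.
    apply: cvgD; last exact: cvg_cst.
    by apply: cvgB; [apply: cvgMl; exact: cvg_id|exact: cvg_cst].
  exact: (cf _ (lt_nbhsr aw)).
by move=> y /= ay; apply: lt_le_trans (kl_fun_ge_tangent y w0); rewrite lte_fin.
Qed.

Lemma divergence_function_kl : divergence_function (@kl_fun R).
Proof.
split.
- exact: kl_fun_ge0.
- exact: kl_fun_convex.
- exact: lower_semicontinuous_kl_fun.
- by rewrite inf_dom_kl_fun lte01.
- by rewrite sup_dom_kl_fun ltry.
- by rewrite kl_funE// ln1 mulr0 sub0r addNr.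
- move=> x y t; rewrite !int_dom_kl_fun /= => x0 y0 /eqP xy /andP[t0 t1].
  have t1p : (0 < 1 - t)%R by rewrite subr_gt0.
  set w := (t * x + (1 - t) * y)%R.
  have w0 : (0 < w)%R by rewrite addr_gt0 ?mulr_gt0.
  rewrite !kl_funE ?ltW// -!EFinM -EFinD lte_fin.
  (* One strict tangent inequality, the one at [x], suffices for a strict average. *)
  have xw : x != w.
    rewrite -subr_eq0 (_ : (x - w = (1 - t) * (x - y))%R); last by rewrite /w; ring.
    by apply: mulf_neq0; [rewrite gt_eqF|rewrite subr_eq0].
  have hx := mul_ln_gt_tangent (ltW x0) w0 xw.
  have hy := mul_ln_ge_tangent (ltW y0) w0.
  rewrite -(ltr_pM2l t0) in hx; rewrite -(ler_pM2l t1p) in hy.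
  have -> : (w * ln w = t * (x * ln w) + (1 - t) * (y * ln w))%R by rewrite /w; ring.
  by lra.
- by move=> x; rewrite int_dom_kl_fun => /is_derive_kl_fun [].
- by move=> x; rewrite int_dom_kl_fun => /is_derive_dphi_kl_fun [].
- move=> x; rewrite int_dom_kl_fun /= => x0.
  rewrite /prop_for/continuous_at derive1_dphi_kl_fun//.
  apply: (@cvg_trans _ ((fun y : R => y^-1%R) @ x)); first apply: near_eq_cvg.
    by near=> y; rewrite derive1_dphi_kl_fun//; near: y; exact: lt_nbhsr.
  by apply: inv_continuous; rewrite gt_eqF.
- by rewrite dphi_kl_fun// ln1.
- by rewrite derive1_dphi_kl_fun// invr1.
- move=> a; rewrite inf_dom_kl_fun => -[<-].
  apply: cvg_trans (@lnNy R); apply: near_eq_cvg.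
  near=> y; rewrite dphi_kl_fun//; near: y; exact: nbhs_right_gt.
- by move=> b; rewrite sup_dom_kl_fun.
Unshelve. all: by end_near. Qed.

End kl_function.

(** * The chi-square function *)

Section chi2_function.
Context {R : realType}.
Implicit Types x y t : R.

Lemma edom_chi2_fun : edom (@chi2_fun R) = setT.
Proof. by apply/seteqP; split=> // x _; rewrite /edom/= ltry. Qed.

Lemma int_dom_chi2_fun x : int_dom chi2_fun x.
Proof.
rewrite /int_dom /inf_dom /sup_dom edom_chi2_fun /=; apply/andP; split.
  apply: (@le_lt_trans _ _ (x - 1)%:E); last by rewrite lte_fin; lra.
  by apply: ereal_inf_lbound; exists (x - 1)%R.
apply: (@lt_le_trans _ _ (x + 1)%:E); first by rewrite lte_fin; lra.
by apply: ereal_sup_ubound; exists (x + 1)%R.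
Qed.

Lemma is_derive_chi2_fun x : is_derive x 1%R (fine \o chi2_fun) (x - 1)%R.
Proof.
have -> : fine \o chi2_fun = (fun y : R => (y - 1) ^+ 2 / 2)%R by [].
by apply: is_derive_eq; rewrite /GRing.scale /=; field.
Qed.

Lemma dphi_chi2_fun : dphi chi2_fun = (fun x => x - 1)%R.
Proof.
apply/funext => x; rewrite /dphi derive1E.
by have [_ ->] := is_derive_chi2_fun x.
Qed.

Lemma is_derive_dphi_chi2_fun x : is_derive x 1%R (dphi chi2_fun) 1%R.
Proof. by rewrite dphi_chi2_fun; apply: is_derive_eq; rewrite subr0. Qed.

Lemma derive1_dphi_chi2_fun : (dphi chi2_fun)^`()%classic = cst (1%R : R).
Proof.
apply/funext => x; rewrite derive1E.
by have [_ ->] := is_derive_dphi_chi2_fun x.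
Qed.

Lemma divergence_function_chi2 : divergence_function (@chi2_fun R).
Proof.
have domT : int_dom (@chi2_fun R) = setT.
  by apply/seteqP; split=> // x _; exact: int_dom_chi2_fun.
have /andP[] := int_dom_chi2_fun 1%R => inf1 sup1.
split=> //.
- by move=> x; rewrite lee_fin divr_ge0// sqr_ge0.
- move=> x y t /andP[t0 t1]; rewrite /chi2_fun -!EFinM -EFinD lee_fin.
  (* Half of this quantity is the gap between the two sides of the convexity inequality. *)
  have : (0 <= t * (1 - t) * (x - y) ^+ 2)%R.
    by rewrite mulr_ge0 ?sqr_ge0// mulr_ge0// subr_ge0.
  by lra.
- move=> x a ax; exists [set y | (a < (y - 1) ^+ 2 / 2)%R] => //.
  have cf : {for x, continuous (fun y : R => ((y - 1) ^+ 2 / 2)%R)}.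
    apply/differentiable_continuous/derivable1_diffP.
    by have [] := is_derive_chi2_fun x.
  exact: (cf _ (lt_nbhsr ax)).
- by rewrite /chi2_fun subrr expr0n mul0r.
- move=> x y t _ _ /eqP xy /andP[t0 t1]; rewrite /chi2_fun -!EFinM -EFinD lte_fin.
  have : (0 < t * (1 - t) * (x - y) ^+ 2)%R.
    apply: mulr_gt0; first by rewrite mulr_gt0// subr_gt0.
    by rewrite lt_neqAle sqr_ge0 eq_sym sqrf_eq0 subr_eq0 xy.
  by lra.
- by move=> x _; have [] := is_derive_dphi_chi2_fun x.
- by move=> x _; rewrite derive1_dphi_chi2_fun; exact: cvg_cst.
- by rewrite dphi_chi2_fun subrr.
- by rewrite derive1_dphi_chi2_fun.
- move=> a aE; have := int_dom_chi2_fun a.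
  by rewrite /int_dom /= aE ltxx.
- move=> a aE; have := int_dom_chi2_fun a.
  by rewrite /int_dom /= aE ltxx andbF.
Qed.

End chi2_function.

(** * Tangents of a divergence function and the equality case of Fenchel's inequality *)

Section convex_conjugate.
Context {R : realType}.
Variable phi : R -> \bar R.
Hypothesis phiP : divergence_function phi.
Implicit Types x y t : R.

(** A point strictly between the infimum and the supremum of the domain lies between two points of
    the domain, and convexity bounds its value by theirs. *)
Lemma int_dom_edom x : int_dom phi x -> edom phi x.
Proof.
move=> /andP[/ereal_inf_ltP[_ [a adom <-]] + /ereal_sup_gtP[_ [b bdom <-]]].
rewrite !lte_fin => ax xb.
have ba : (0 < b - a)%R by rewrite subr_gt0 (lt_trans ax).
pose t := ((b - x) / (b - a))%R.
have t01 : (0 <= t <= 1)%R.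
  rewrite ler_pdivrMr// mul1r lerD2l lerN2 (ltW ax) andbT.
  by apply: divr_ge0; rewrite ltW// subr_gt0.
have xE : (x = t * a + (1 - t) * b)%R by rewrite /t; field; rewrite gt_eqF.
rewrite /edom /= xE; apply: le_lt_trans (divf_convex phiP _ _ t01) _.
case/andP: t01 => t0 t1.
by rewrite lte_add_pinfty// lte_mul_pinfty ?lee_fin ?subr_ge0//.
Qed.

Lemma edom_fin_num x : edom phi x -> phi x \is a fin_num.
Proof. by move=> xdom; rewrite ge0_fin_numE ?(divf_ge0 phiP). Qed.

(** By convexity, the difference quotients at [x] in the direction [y - x] are at most
    [phi y - phi x] for steps in ]0, 1]; the step then tends to 0 from the right. *)
Lemma tangent_le x y : int_dom phi x ->
  (dphi phi x * (y - x))%:E + phi x <= phi y.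
Proof.
move=> xint; have xfin := edom_fin_num (int_dom_edom xint).
have [yoo|] := eqVneq (phi y) +oo; first by rewrite yoo leey.
rewrite -ltey => ydom; have yfin := edom_fin_num ydom.
have chord t : (0 < t <= 1)%R ->
    (fine (phi (x + t * (y - x))) - fine (phi x) <=
     t * (fine (phi y) - fine (phi x)))%R.
  move=> /andP[t0 t1]; have t01 : (0 <= t <= 1)%R by rewrite ltW.
  have := divf_convex phiP y x t01.
  have -> : (t * y + (1 - t) * x = x + t * (y - x))%R by ring.
  rewrite -(fineK xfin) -(fineK yfin) -!EFinM -EFinD => le_chord.
  have zfin : phi (x + t * (y - x)) \is a fin_num.
    by apply: edom_fin_num; apply: le_lt_trans le_chord _; exact: ltry.
  by move: le_chord; rewrite -(fineK zfin) lee_fin /=; lra.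
rewrite -(fineK xfin) -(fineK yfin) -EFinD lee_fin -lerBrDr.
have dx : derivable (fine \o phi) x (y - x)%R.
  by apply/diff_derivable/derivable1_diffP/(divf_derivable phiP).
have -> : (dphi phi x * (y - x) = 'D_(y - x) (fine \o phi) x)%R.
  have dF : differentiable (fine \o phi) x.
    by apply/derivable1_diffP/(divf_derivable phiP).
  rewrite /dphi derive1E !deriveE// mulrC -[in RHS](mulr1 (y - x)%R).
  exact/esym/linearZ.
apply: (cvgr_to_le (cvg_dnbhs_at_right dx)); near=> t.
have t0 : (0 < t)%R by near: t; exact: nbhs_right_gt.
rewrite /= /GRing.scale /= ler_pdivrMl// [(_ + x)%R]addrC chord// t0 /=.
by near: t; apply: nbhs_right_le; exact: ltr01.
Unshelve. all: by end_near. Qed.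

(** The tangent inequality says that the supremum defining the conjugate at the slope [dphi phi x]
    is attained at [x]. *)
Lemma conjugate_dphi x : int_dom phi x ->
  conjugate phi (dphi phi x) = (dphi phi x * x)%:E - phi x.
Proof.
move=> xint; have xfin := edom_fin_num (int_dom_edom xint).
apply/eqP; rewrite eq_le; apply/andP; split; last first.
  by apply: ereal_sup_ubound; exists x.
apply: ge_ereal_sup => _ [y _ <-].
have := tangent_le y xint; rewrite -(fineK xfin); case: (phi y) => [r| |//].
  by rewrite -EFinD -!EFinB !lee_fin; lra.
by rewrite addeNy leNye.
Qed.

End convex_conjugate.

(** * Real-valued densities and change of measure *)

Definition density d (T : measurableType d) (R : realType)
    (Q P : probability T R) : T -> R :=
  fine \o Radon_Nikodym_SigmaFinite.f Q P.

Section density.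
Context d (T : measurableType d) (R : realType) (Q P : probability T R).
Hypothesis QP : Q `<< P.
Local Notation q := (density Q P).

Lemma EFin_density z : (q z)%:E = Radon_Nikodym_SigmaFinite.f Q P z.
Proof. by rewrite /density /= fineK// Radon_Nikodym_SigmaFinite.f_fin_num. Qed.

Lemma density_ge0 z : (0 <= q z)%R.
Proof. by rewrite -lee_fin EFin_density Radon_Nikodym_SigmaFinite.f_ge0. Qed.

Lemma measurable_density : measurable_fun setT q.
Proof.
apply/measurable_EFinP.
rewrite (_ : EFin \o q = Radon_Nikodym_SigmaFinite.f Q P).
  exact: measurable_int (Radon_Nikodym_SigmaFinite.f_integrable QP).
by apply/funext => z; exact: EFin_density.
Qed.

(** Links the derivative used in [divergence] and [has_density] to a version that is finite and
    nonnegative at every point. *)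
Lemma ae_eq_density :
  {ae P, forall z, Radon_Nikodym (charge_of_finite_measure Q) P z = (q z)%:E}.
Proof.
have := ae_eq_Radon_Nikodym_SigmaFinite QP measurableT.
by apply: filterS => z /(_ I); rewrite EFin_density => ->.
Qed.

Lemma ge0_integral_density (f : T -> \bar R) :
  measurable_fun setT f -> (forall z, 0 <= f z) ->
  \int[P]_z (f z * (q z)%:E) = \int[Q]_z f z.
Proof.
move=> mf f0; under eq_integral do rewrite EFin_density.
exact: Radon_Nikodym_SigmaFinite.change_of_variables.
Qed.

Lemma integrable_density (f : T -> R) :
  Q.-integrable setT (EFin \o f) ->
  P.-integrable setT (fun z => (f z * q z)%:E).
Proof.
move=> /integrableP[mef fi].
have mf : measurable_fun setT f by apply/measurable_EFinP; exact: mef.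
apply/integrableP; split.
  by apply/measurable_EFinP/measurable_funM => //; exact: measurable_density.
under eq_integral do rewrite /= normrM (ger0_norm (density_ge0 _)) EFinM.
by rewrite (ge0_integral_density (f := fun z => `|f z|%:E))//;
  exact/measurable_EFinP/measurableT_comp.
Qed.

Lemma integral_density (f : T -> R) :
  Q.-integrable setT (EFin \o f) ->
  \int[P]_z (f z * q z)%:E = \int[Q]_z (f z)%:E.
Proof.
move=> fi; rewrite -(Radon_Nikodym_change_of_variables QP measurableT fi).
apply: ae_eq_integral => //.
- by apply: measurable_int; exact: integrable_density.
- apply: emeasurable_funM; first exact: measurable_int fi.
  by apply: measurable_int; exact: Radon_Nikodym_integrable.
- by apply: filterS ae_eq_density => z /= -> _; rewrite EFinM.
Qed.

End density.

(** * The density of an image measure compared with the original density *)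

Section pushforward_density.
Context d d' (T : measurableType d) (S : measurableType d') (R : realType).
Context (Q P : probability T R) (pi : {mfun T >-> S}) (P' : probability S R).
Hypothesis QP : Q `<< P.
Hypothesis QP' : distribution Q pi `<< P'.
Local Notation q := (density Q P).
Local Notation q' := (density (distribution Q pi) P').

(** The image of [Q] gives no mass to the set where its density [q'] vanishes, so [Q] gives none to
    the preimage, and [q] must vanish there almost everywhere. *)
Lemma ae_density_eq0 : {ae P, forall z, q' (pi z) = 0%R -> q z = 0%R}.
Proof.
pose g := fun x => (\1_[set x | q' x = 0%R] x)%:E : \bar R.
have mq' := measurable_density QP'.
have mN : measurable [set x | q' x = 0%R].
  by have := mq' measurableT _ (measurable_set1 (0 : R)%R); rewrite setTI.
have mg : measurable_fun setT g by exact/measurable_EFinP/measurable_indic.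
have g0 x : 0 <= g x by rewrite lee_fin.
have mgpi : measurable_fun setT (g \o pi) by exact: measurableT_comp.
have int0 : \int[P]_z `|(g \o pi) z * (q z)%:E| = 0.
  under eq_integral => z _ do
    rewrite gee0_abs ?mule_ge0 ?lee_fin ?density_ge0//=.
  rewrite (ge0_integral_density QP (f := g \o pi))//; last by move=> z; exact: g0.
  rewrite -(ge0_integral_distribution pi mg g0).
  rewrite -(ge0_integral_density QP')//.
  apply: integral0_eq => x _; rewrite /g indicE.
  by case: (boolP (x \in _)) => [|_]; rewrite ?mul0e// inE /= => ->; rewrite mule0.
have mgq : measurable_fun setT (fun z => (g \o pi) z * (q z)%:E).
  by apply: emeasurable_funM => //; apply/measurable_EFinP/measurable_density.
have := (ae_eq_integral_abs P measurableT mgq).1 int0.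
apply: filterS => z /(_ I); rewrite /g /= indicE => /eqP qz q'z.
by move: qz; rewrite mem_set//= mul1e => /eqP [].
Qed.

(* [expR (- ln x)] is [x^-1] for [x > 0], and [1] for [x = 0] since [ln 0 = 0]. *)
Lemma integral_density_expRN_ln :
  \int[P]_z (q z * expR (- ln (q' (pi z))))%:E <= 1.
Proof.
have mq' := measurable_density QP'.
pose g := fun x => (expR (- ln (q' x)))%:E : \bar R.
have mg : measurable_fun setT g.
  apply/measurable_EFinP/measurableT_comp => //; apply: measurableT_comp => //.
  by apply: measurableT_comp => //; exact: measurable_ln.
have g0 x : 0 <= g x by rewrite lee_fin expR_ge0.
under eq_integral do rewrite mulrC EFinM -/(g _).
rewrite (ge0_integral_density QP (f := g \o pi))//; last 2 first.
- exact: measurableT_comp.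
- by move=> z; exact: g0.
(* Carried over to [P'], the integrand is 1 where [q'] is positive and 0 elsewhere, so that the
   total mass of [P'] bounds its integral. *)
rewrite -(ge0_integral_distribution pi mg g0) -(ge0_integral_density QP')//.
rewrite -(@probability_setT _ _ _ P') -[leRHS]mul1e -integral_cst//.
apply: ge0_le_integral => //.
- by move=> x _; rewrite mule_ge0// lee_fin density_ge0.
- by apply: emeasurable_funM => //; exact/measurable_EFinP.
- move=> x _; rewrite /g -EFinM lee_fin.
  have [->|q'n0] := eqVneq (q' x) 0%R; first by rewrite mulr0.
  have q'0 : (0 < q' x)%R by rewrite lt_neqAle eq_sym q'n0 density_ge0.
  by rewrite expRN lnK// mulVf.
Qed.

End pushforward_density.

(** * Margins and the density of [perp Q] with respect to [perp P] *)

Section perp_density.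
Context {R : realType} {dX dY : measure_display}
  {X : measurableType dX} {Y : measurableType dY}.
Implicit Types P Q : probability (X * Y)%type R.

(** The cylinder over a null set of the first margin is null for the product [perp P]. *)
Lemma margin1_dominates Q P : Q `<< perp P -> margin1 Q `<< margin1 P.
Proof.
move=> /null_content_dominatesP QP; apply/null_content_dominatesP => A mA A0.
have -> : margin1 Q A = Q (A `*` setT).
  rewrite /margin1 /distribution /pushforward; congr (Q _).
  by apply/seteqP; split=> [z|z []].
apply: QP; first exact: measurableX.
by rewrite [LHS]product_measure1E// A0 mul0e.
Qed.

Lemma margin2_dominates Q P : Q `<< perp P -> margin2 Q `<< margin2 P.
Proof.
move=> /null_content_dominatesP QP; apply/null_content_dominatesP => A mA A0.
have -> : margin2 Q A = Q (setT `*` A).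
  rewrite /margin2 /distribution /pushforward; congr (Q _).
  by apply/seteqP; split=> [z|z []].
apply: QP; first exact: measurableX.
by rewrite [LHS]product_measure1E// A0 mule0.
Qed.

(** Tonelli's theorem turns both sides into iterated integrals, in which each margin changes density
    separately. *)
Lemma ge0_integral_perp_density Q P (f : X * Y -> \bar R) :
  margin1 Q `<< margin1 P -> margin2 Q `<< margin2 P ->
  measurable_fun setT f -> (forall z, 0 <= f z) ->
  \int[perp P]_z (f z * (density (margin1 Q) (margin1 P) z.1 *
                         density (margin2 Q) (margin2 P) z.2)%:E) =
  \int[perp Q]_z f z.
Proof.
move=> QP1 QP2 mf f0.
set q1 := density _ _; set q2 := density _ _.
have mq1 : measurable_fun setT q1 by exact: measurable_density.
have mq2 : measurable_fun setT q2 by exact: measurable_density.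
have q10 x : (0 <= q1 x)%R by exact: density_ge0.
have q20 x : (0 <= q2 x)%R by exact: density_ge0.
rewrite [LHS]fubini_tonelli1//=; last 2 first.
- apply: emeasurable_funM => //; apply/measurable_EFinP/measurable_funM.
    by apply: measurableT_comp.
  by apply: measurableT_comp.
- by move=> z; rewrite mule_ge0// lee_fin mulr_ge0.
rewrite [RHS]fubini_tonelli1//.
rewrite -(ge0_integral_density QP1)//; last 2 first.
- exact: measurable_fun_fubini_tonelli_F.
- by move=> x; exact: integral_ge0.
apply: eq_integral => x _; rewrite /fubini_F.
have mfx : measurable_fun setT (fun y => f (x, y)) by exact: measurableT_comp.
rewrite -(ge0_integral_density QP2)// -ge0_integralZr//.
- by apply: eq_integral => y _; rewrite EFinM muleA muleAC.
- by apply: emeasurable_funM => //; exact/measurable_EFinP.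
- by move=> y _; rewrite mule_ge0// lee_fin.
- by rewrite lee_fin.
Qed.

End perp_density.

Lemma integral_cst_probability d (T : measurableType d) (R : realType)
    (P : probability T R) (r : R) : \int[P]_z r%:E = r%:E.
Proof. by rewrite -[RHS]mule1 -(probability_setT P); exact: integral_cst. Qed.

(** The positive part of [f] lies between [f] and [g] almost everywhere. The integral of [g] may be
    infinite, as a divergence may be. *)
Lemma ge0_integral_ge_integrable d (T : measurableType d) (R : realType)
    (mu : {measure set T -> \bar R}) (f g : T -> \bar R) :
  mu.-integrable setT f -> measurable_fun setT g -> (forall z, 0 <= g z) ->
  {ae mu, forall z, f z <= g z} -> \int[mu]_z f z <= \int[mu]_z g z.
Proof.
move=> fi mg g0 fg; apply: (@le_trans _ _ (\int[mu]_z f^\+ z)).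
  apply: le_integral => //; first exact: integrable_funepos.
  by move=> z _; rewrite funeposE le_max lexx.
apply: ae_ge0_le_integral => //.
  exact/measurable_funepos/(measurable_int mu).
by apply: filterS fg => z fgz _; rewrite funeposE ge_max fgz g0.
Qed.

Lemma divergence_density d (T : measurableType d) (R : realType)
    (phi : R -> \bar R) (Q P : probability T R) :
  measurable_fun setT phi -> Q `<< P ->
  divergence phi Q P = \int[P]_z phi (density Q P z).
Proof.
move=> mphi QP; rewrite /divergence asboolT//; apply: ae_eq_integral => //.
- apply: (measurableT_comp mphi); apply: measurableT_comp; first exact: fine_measurable.
  have RN_int : P.-integrable setT
      (Radon_Nikodym (charge_of_finite_measure Q) P).
    exact: Radon_Nikodym_integrable.
  exact: measurable_int RN_int.
- by apply: (measurableT_comp mphi); exact: measurable_density.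
- by apply: filterS (ae_eq_density QP) => z /= -> _.
Qed.

(** * The dual lower bound on the Kullback-Leibler divergence *)

Section kl_lower_bound.
Context {R : realType}.

(** The tangent at [u * (q1 * q2)] brings in [ln q1] and [ln q2]; adding
    [q * expR (- ln q1) >= q * (1 - ln q1)] and its analogue for [q2] cancels them and leaves
    [2 * q]. Every term on the right is nonnegative and can be integrated separately. *)
Lemma kl_fun_ge_margins (q q1 q2 u : R) :
  (0 <= q)%R -> (0 <= q1)%R -> (0 <= q2)%R -> (0 < u)%R ->
  (q1 = 0 -> q = 0)%R -> (q2 = 0 -> q = 0)%R ->
  (1 + (ln u + 2) * q)%:E <=
  kl_fun q + (q * expR (- ln q1))%:E + (q * expR (- ln q2))%:E +
  (u * (q1 * q2))%:E.
Proof.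
move=> q0 q10 q20 u0 q1q q2q.
rewrite kl_funE// -!EFinD lee_fin.
have [->|qn0] := eqVneq q 0%R.
  rewrite mulr0 !mul0r !addr0 subrr add0r lerDl.
  by rewrite mulr_ge0 ?mulr_ge0// ltW.
have q1p : (0 < q1)%R.
  by rewrite lt_neqAle q10 andbT eq_sym; apply: contra qn0 => /eqP/q1q ->.
have q2p : (0 < q2)%R.
  by rewrite lt_neqAle q20 andbT eq_sym; apply: contra qn0 => /eqP/q2q ->.
have w0 : (0 < u * (q1 * q2))%R by rewrite !mulr_gt0.
have := mul_ln_ge_tangent q0 w0.
rewrite !lnM ?posrE ?mulr_gt0//.
have e1 := ler_wpM2l q0 (expR_ge1Dx (- ln q1)).
have e2 := ler_wpM2l q0 (expR_ge1Dx (- ln q2)).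
by lra.
Qed.

Context {dX dY : measure_display}
  {X : measurableType dX} {Y : measurableType dY}.
Implicit Types P Q : probability (X * Y)%type R.

(** Integrating the pointwise bound against [perp P] gives 3 plus the [Q]-integral of [ln u] on the
    left, and the divergence plus 2 plus the [perp Q]-integral of [u] on the right. Writing [u] as
    [(u - 1) + 1] makes the constants cancel. *)
Lemma kl_divergence_perp_ge P Q (u : X * Y -> R) :
  Q `<< perp P -> (forall z, (0 < u z)%R) ->
  Q.-integrable setT (EFin \o (@ln R \o u)) ->
  (perp Q).-integrable setT (fun z => (u z - 1)%:E) ->
  \int[Q]_z (ln (u z))%:E - \int[perp Q]_z (u z - 1)%:E <=
  divergence kl_fun Q (perp P).
Proof.
move=> QP u0 lnu_int u1_int.
have QP1 := margin1_dominates QP; have QP2 := margin2_dominates QP.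
have mkl : measurable_fun setT (@kl_fun R).
  exact: (lower_semicontinuous_measurable lower_semicontinuous_kl_fun).
rewrite (divergence_density mkl QP).
set q := density _ _.
pose q1 := density (margin1 Q) (margin1 P).
pose q2 := density (margin2 Q) (margin2 P).
have q0 z : (0 <= q z)%R by exact: density_ge0.
have q10 z : (0 <= q1 z)%R by exact: density_ge0.
have q20 z : (0 <= q2 z)%R by exact: density_ge0.
have mq : measurable_fun setT q by exact: measurable_density.
have mq1 : measurable_fun setT (fun z : X * Y => q1 z.1).
  by apply: measurableT_comp; [exact: measurable_density|exact: measurable_fst].
have mq2 : measurable_fun setT (fun z : X * Y => q2 z.2).
  by apply: measurableT_comp; [exact: measurable_density|exact: measurable_snd].
have mu : measurable_fun setT u.
  have mu1 : measurable_fun setT (fun z => u z - 1)%R.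
    by apply/measurable_EFinP; exact: measurable_int u1_int.
  rewrite (_ : u = (fun z => (u z - 1) + 1)%R); first exact: measurable_funD.
  by apply/funext => z; rewrite subrK.
have m_ratio (g : X * Y -> R) : measurable_fun setT g ->
    measurable_fun setT (fun z => (q z * expR (- ln (g z)))%:E).
  move=> mg; apply/measurable_EFinP/measurable_funM => //.
  apply: measurableT_comp => //; apply: measurableT_comp => //.
  by apply: measurableT_comp => //; exact: measurable_ln.
have U_E : \int[perp Q]_z (u z)%:E = \int[perp Q]_z (u z - 1)%:E + 1.
  rewrite -[in RHS](integral_cst_probability (perp Q) 1).
  rewrite -integralD//; last exact: finite_measure_integrable_cst.
  by apply: eq_integral => z _; rewrite -EFinD subrK.
have lnu2_int : Q.-integrable setT (EFin \o (fun z => ln (u z) + 2)%R).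
  exact: (integrableD measurableT lnu_int
    (finite_measure_integrable_cst Q 2 measurableT)).
have L_E : \int[perp P]_z (1 + (ln (u z) + 2) * q z)%:E =
    1 + (\int[Q]_z (ln (u z))%:E + 2%:E).
  under eq_integral do rewrite EFinD.
  rewrite integralD//; last 2 first.
  - exact: finite_measure_integrable_cst.
  - exact: integrable_density.
  rewrite integral_cst_probability integral_density//.
  congr (_ + _); under eq_integral do rewrite EFinD.
  rewrite integralD//; last exact: finite_measure_integrable_cst.
  by rewrite integral_cst_probability.
have : \int[perp P]_z (1 + (ln (u z) + 2) * q z)%:E <=
    \int[perp P]_z kl_fun (q z) + 1 + 1 + \int[perp Q]_z (u z)%:E.
  have mklq : measurable_fun setT (fun z => kl_fun (q z)).
    exact: (measurableT_comp mkl mq).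
  apply: (@le_trans _ _ (\int[perp P]_z (kl_fun (q z) +
      (q z * expR (- ln (q1 z.1)))%:E + (q z * expR (- ln (q2 z.2)))%:E +
      (u z * (q1 z.1 * q2 z.2))%:E))).
    apply: ge0_integral_ge_integrable.
    - exact: (integrableD measurableT (finite_measure_integrable_cst (perp P) 1
        measurableT) (integrable_density QP lnu2_int)).
    - apply: emeasurable_funD; last first.
        apply/measurable_EFinP/measurable_funM => //.
        exact: measurable_funM.
      apply: emeasurable_funD; last exact: m_ratio mq2.
      by apply: emeasurable_funD => //; exact: m_ratio mq1.
    - move=> z; rewrite !adde_ge0 ?kl_fun_ge0 ?lee_fin ?mulr_ge0 ?expR_ge0//.
      exact: ltW.
    (* Almost everywhere, [q] vanishes wherever a marginal density does, so the default value of
       [ln] at 0 does no harm. *)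
    - have := ae_density_eq0 (pi := @fst X Y) QP QP1.
      have := ae_density_eq0 (pi := @snd X Y) QP QP2.
      by apply: filterS2 => z h2 h1; exact: kl_fun_ge_margins.
  rewrite ge0_integralD//=; last 4 first.
  - move=> z _; rewrite !adde_ge0 ?kl_fun_ge0 ?lee_fin ?mulr_ge0 ?expR_ge0//.
  - apply: emeasurable_funD; last exact: m_ratio mq2.
    by apply: emeasurable_funD => //; exact: m_ratio mq1.
  - by move=> z _; rewrite lee_fin !mulr_ge0// ltW.
  - apply/measurable_EFinP/measurable_funM => //.
    exact: measurable_funM.
  rewrite ge0_integralD//=; last 4 first.
  - by move=> z _; rewrite adde_ge0 ?kl_fun_ge0 ?lee_fin ?mulr_ge0 ?expR_ge0.
  - by apply: emeasurable_funD => //; exact: m_ratio mq1.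
  - by move=> z _; rewrite lee_fin mulr_ge0// expR_ge0.
  - exact: m_ratio mq2.
  rewrite ge0_integralD//=; last 3 first.
  - by move=> z _; exact: kl_fun_ge0.
  - by move=> z _; rewrite lee_fin mulr_ge0// expR_ge0.
  - exact: m_ratio mq1.
  rewrite -(ge0_integral_perp_density (P := P) QP1 QP2 (f := EFin \o u))//; last 2 first.
  - exact/measurable_EFinP.
  - by move=> z; rewrite lee_fin ltW.
  apply: leeD; last by under eq_integral do rewrite EFinM.
  apply: leeD; last exact: (integral_density_expRN_ln (pi := @snd X Y)).
  by apply: leeD => //; exact: (integral_density_expRN_ln (pi := @fst X Y)).
rewrite L_E U_E.
(* The integrals of [ln u] and [u - 1] are finite, so only the divergence can be infinite, and then
   the bound is trivial. *)
have := integrable_fin_num measurableT lnu_int.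
have := integrable_fin_num measurableT u1_int.
rewrite /comp => /fineK <- /fineK <-.
case: (\int[perp P]_z kl_fun (q z)) => [k| |]; rewrite ?leey//.
by rewrite -!EFinB -!EFinD !lee_fin; lra.
Qed.

End kl_lower_bound.

(** The hypothesis on [P] bears on the space: it is finite with measurable points, so every function
    is measurable and bounded. Hence [Q] is arbitrary, and may be a product of margins. *)
Lemma finite_discrete_integrable {R : realType} {dX dY : measure_display}
    {X : measurableType dX} {Y : measurableType dY}
    (P Q : probability (X * Y)%type R) (f : X * Y -> R) :
  finite_discrete P -> Q.-integrable setT (EFin \o f).
Proof.
move=> [Xfin Yfin mset1 _].
have XYfin : finite_set [set: X * Y] by rewrite -setXTT; exact: finite_setX.
have mall (A : set (X * Y)) : measurable A.
  rewrite -[A]image_id -bigcup_imset1.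
  apply: fin_bigcup_measurable => [|z _]; last exact: mset1.
  exact: sub_finite_set XYfin.
apply: measurable_bounded_integrable => //.
  exact: le_lt_trans (probability_le1 _ measurableT) (ltry _).
have [s sE] := (finite_seqP _).1 XYfin.
exists (\sum_(z <- s) `|f z|)%R; split; first exact: num_real.
move=> M sM z _; apply: le_trans (ltW sM).
have zs : z \in s by have : [set` s] z by rewrite -sE.
by rewrite (big_rem z)//= lerDl sumr_ge0.
Qed.

(** * Comparison of the Bahadur slopes *)

Section slopes.
Context {R : realType} {dX dY : measure_display}
  {X : measurableType dX} {Y : measurableType dY} {d : nat}.
Variables (Theta : set 'rV[R]_(1 + d)) (h : 'rV[R]_(1 + d) -> X * Y -> R).
Implicit Types (P Q : probability (X * Y)%type R) (phi : R -> \bar R).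

(** Integrating the Fenchel equality at [h theta], a version of the density of [P], shows that the
    mutual information is the term of index [theta] in the supremum. *)
Lemma mutual_information_le_dual phi P theta : divergence_function phi ->
  Theta theta -> has_density P (perp P) (h theta) ->
  (forall z, int_dom phi (h theta z)) -> M_G Theta h phi P ->
  mutual_information phi P <= dual_divergence Theta h phi P.
Proof.
move=> phiP Th [PP hE] hint /(_ _ Th) [fi gi].
set f := f_ h phi theta in fi *; set g := g_ h phi theta in gi *.
have mphi := lower_semicontinuous_measurable (divf_closed phiP).
set q := density P (perp P).
have phi_h z : phi (h theta z) = (f z * h theta z - g z)%:E.
  have hfin := edom_fin_num phiP (int_dom_edom phiP (hint z)).
  rewrite /g /g_ (conjugate_dphi phiP (hint z)) -(fineK hfin) -EFinB /=.
  by rewrite opprB addrC subrK.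
have qE : {ae perp P, forall z, q z = h theta z}.
  by apply: filterS2 (ae_eq_density PP) hE => z -> [].
suff -> : mutual_information phi P =
    \int[P]_z (f z)%:E - \int[perp P]_z (g z)%:E.
  by apply: ereal_sup_ubound; exists theta.
rewrite /mutual_information divergence_density// -(integral_density PP fi).
have fq_int := integrable_density PP fi.
rewrite -integralB_EFin//; apply: ae_eq_integral => //.
- by apply: (measurableT_comp mphi); exact: measurable_density.
- exact: measurable_int (integrableB measurableT fq_int gi).
- by apply: filterS qE => z qz _; rewrite -/q qz phi_h EFinB.
Qed.

(** For [kl_fun], [f_] is [ln (h theta)] and [g_] is [h theta - 1], so each term of the supremum is
    the dual bound with [u] equal to [h theta]. *)
Lemma dual_kl_le_divergence P Q :
  (forall theta z, Theta theta -> (0 < h theta z)%R) ->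
  M_G Theta h kl_fun Q ->
  dual_divergence Theta h kl_fun Q <= divergence kl_fun Q (perp P).
Proof.
move=> h0 QM; have [QP|nQP] := pselect (Q `<< perp P); last first.
  by rewrite /divergence asboolF// leey.
have fE theta z : Theta theta -> f_ h kl_fun theta z = ln (h theta z).
  by move=> Th; rewrite /f_ dphi_kl_fun ?h0.
have gE theta z : Theta theta -> g_ h kl_fun theta z = (h theta z - 1)%R.
  move=> Th; have hz := h0 _ z Th.
  rewrite /g_ conjugate_dphi ?int_dom_kl_fun//; last exact: divergence_function_kl.
  by rewrite dphi_kl_fun// kl_funE ?ltW//=; ring.
apply: ge_ereal_sup => _ [theta Th <-]; have [fi gi] := QM _ Th.
under eq_integral do rewrite fE//.
under [X in _ - X]eq_integral do rewrite gE//.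
apply: kl_divergence_perp_ge => //.
- by move=> z; exact: h0.
- by apply: eq_integrable fi => // z _; rewrite /= fE.
- by apply: eq_integrable gi => // z _; rewrite /= gE.
Qed.

(** [M] and [C] are kept abstract so that the exponential and the finite-discrete cases are both
    instances. *)
Lemma bahadur_most_efficient_kl
    (M : (R -> \bar R) -> set (probability (X * Y)%type R))
    (C : (R -> \bar R) -> Prop) P :
  model Theta h P -> C kl_fun ->
  (forall phi, C phi -> regular_model Theta h phi /\ M phi P) ->
  (forall phi Q, C phi -> M phi Q -> M_G Theta h phi Q) ->
  bahadur_most_efficient Theta h M C kl_fun P.
Proof.
move=> [thetaT ThT PthetaT] Ckl CM MG.
split; first exact: divergence_function_kl.
have h0 theta z : Theta theta -> (0 < h theta z)%R.
  have [[hint _ _] _] := CM _ Ckl.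
  by move=> Th; have := hint theta z Th; rewrite int_dom_kl_fun.
move=> phi phiP Cphi; have [[hint _ _] PM] := CM _ Cphi.
(* This value separates the slopes: [P] is admissible for [phi], and every distribution admissible
   for [kl_fun] has at least this divergence. *)
apply: (@le_trans _ _ (mutual_information kl_fun P)).
  apply: ereal_inf_lbound; exists P => //; split=> //.
  apply: (mutual_information_le_dual phiP ThT PthetaT); last exact: MG.
  by move=> z; exact: hint.
apply: le_ereal_inf_tmp => _ [Q [QM PQ] <-]; apply: le_trans PQ _.
by apply: dual_kl_le_divergence => //; exact: MG.
Qed.

End slopes.

(** * Optimality in the exponential and finite-discrete cases, with the chi-square test as an
    instance *)

Theorem theorem4p2 (R : realType) (dX dY : measure_display)
    (X : measurableType dX) (Y : measurableType dY) (d : nat)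
    (Theta : set 'rV[R]_(1 + d)) (h : 'rV[R]_(1 + d) -> X * Y -> R)
    (h_meas : forall theta, Theta theta -> measurable_fun setT (h theta))
    (A1 : identifiable Theta h)
    (A2 : interior_null Theta h)
    (A5 : compact Theta)
    (P : probability (X * Y)%type R)
    (P_model : model Theta h P)
    (thetaT : 'rV[R]_(1 + d))
    (thetaT_true : true_parameter Theta h P thetaT)
    (thetaT_int : Theta^° thetaT)
    (P_dep : ~ independent P) :
  (exponential_model Theta h P ->
   regular_exponential_case Theta h P kl_fun ->
   bahadur_most_efficient Theta h (M_G Theta h)
     (regular_exponential_case Theta h P) kl_fun P /\
   (regular_exponential_case Theta h P chi2_fun ->
    bahadur_slope Theta h (M_G Theta h) chi2_fun P <=
    bahadur_slope Theta h (M_G Theta h) kl_fun P)) /\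
  (finite_discrete P ->
   regular_model Theta h kl_fun ->
   bahadur_most_efficient Theta h (fun=> finite_discrete)
     (regular_model Theta h) kl_fun P /\
   (regular_model Theta h chi2_fun ->
    bahadur_slope Theta h (fun=> finite_discrete) chi2_fun P <=
    bahadur_slope Theta h (fun=> finite_discrete) kl_fun P)).
Proof.
split=> [_ kl_regular|P_finite kl_regular].
  suff kl_best : bahadur_most_efficient Theta h (M_G Theta h)
      (regular_exponential_case Theta h P) kl_fun P.
    by split; [exact: kl_best|exact: (kl_best.2 _ divergence_function_chi2)].
  by apply: bahadur_most_efficient_kl => // phi [].
suff kl_best : bahadur_most_efficient Theta h (fun=> finite_discrete)
    (regular_model Theta h) kl_fun P.
  by split; [exact: kl_best|exact: (kl_best.2 _ divergence_function_chi2)].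
apply: bahadur_most_efficient_kl => // phi Q _ Q_finite theta _.
(* On a finite space, both integrability conditions of [M_G] hold for any distribution. *)
by split; exact: finite_discrete_integrable Q_finite.
Qed.
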